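(* Let $p \geq 5$ be any prime, let $n \geq 1$ be any integer, and let $G = \mathrm{SL}_2(\mathbb{Z}/p^n\mathbb{Z})$. Then every complex irreducible character of $G$ that is trivial on the central involution $\boldsymbol{z} = -I_2$ of $G$ (i.e. has $\boldsymbol{z}$ in its kernel) is a constituent of the conjugation character $\pi_G$ of $G$.
   Context: For a finite group $G$, the conjugation representation $\Pi_G$ is the complex representation of $G$ on the group algebra $\mathbb{C}G$ (the vector space with basis $\{x \mid x\in G\}$) in which $g \in G$ acts by $x \mapsto gxg^{-1}$ on basis elements. Its character is the conjugation character $\pi_G$. An irreducible character $\chi$ is a constituent of $\pi_G$ if the inner product $[\pi_G,\chi]_G$ is nonzero. *)

(* Defs.v *)
From mathcomp Require Import all_boot all_order all_fingroup all_algebra.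
From mathcomp Require Import all_solvable all_field all_character.

Set Implicit Arguments.
Unset Strict Implicit.
Unset Printing Implicit Defensive.

Import GroupScope GRing.Theory.
Local Open Scope ring_scope.

Section SpecialLinear.

Variables (n : nat) (R : finComUnitRingType).

Definition SLset : {set {'GL_n[R]}} := [set u : {'GL_n[R]} | \det u == 1].

Lemma SLset_group_set : group_set SLset.
Proof.
apply/group_setP; split=> [|u v]; first by rewrite inE GL_1E det1.
by rewrite !inE GL_MxE det_mulmx => /eqP-> /eqP->; rewrite mulr1.
Qed.

Canonical SL : {group {'GL_n[R]}} := Group SLset_group_set.

Fact GL_opp1_unit : (- 1%:M : 'M[R]_n.-1.+1) \is a GRing.unit.
Proof. exact: unitrN1. Qed.

Definition GL_opp1 : {'GL_n[R]} := FinRing.Unit GL_opp1_unit.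

End SpecialLinear.

Section ConjugationRepresentation.

Variables (gT : finGroupType) (G : {group gT}).

(* algC stands in for the complex numbers: a finite group has the same        *)
(* irreducible characters over both. Row and column j correspond     *)
(* to the basis element x = enum_val j of the group algebra; the matrix acts  *)
(* on column vectors, so its column j is the image g x g^-1 of x.             *)
Definition conj_mx (g : gT) : 'M[algC]_#|G| :=
  \matrix_(i, j) (enum_val i == (g * enum_val j * g^-1)%g)%:R.

Lemma conj_mx_repr : mx_repr G conj_mx.
Proof.
split=> [|g h Gg Gh]; apply/matrixP=> i j; rewrite !mxE.
  by rewrite mul1g invg1 mulg1 (inj_eq enum_val_inj).
have Gk : (h * enum_val j * h^-1)%g \in G.
  by rewrite !groupM ?groupV ?enum_valP.
rewrite (bigD1 (gring_index G (h * enum_val j * h^-1)%g)) //= !mxE.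
rewrite gring_indexK // eqxx mulr1 big1 ?addr0 => [|k nk].
  by rewrite invMg !mulgA.
rewrite !mxE; case: (enum_val k =P _) => [ek|_]; last by rewrite mulr0.
by case/eqP: nk; rewrite -ek gring_valK.
Qed.

Definition conj_repr : mx_representation algC G #|G| :=
  MxRepresentation conj_mx_repr.

Definition conj_char : 'CF(G) := cfRepr conj_repr.

End ConjugationRepresentation.

(* Main.v *)
Require Import Defs.
From mathcomp Require Import all_boot all_order all_fingroup all_algebra.
From mathcomp Require Import all_solvable all_field all_character.
From mathcomp Require Import ring.

(** The conjugation character is the sum, over the conjugacy classes of G, of
the permutation characters induced from the trivial characters of the
centralisers. By Frobenius reciprocity a character chi is therefore a
constituent of it as soon as some x in G has a centraliser that fixes a nonzero
vector in a representation V affording chi (conj_char_constt). For SL_2 over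
R = Z/p^n a single x serves for all chi at once: x = diag(2, 1/2). Since
p >= 5, the difference 2 - 1/2 is a unit, so the centraliser of x is the
diagonal torus T (centralizer_torus).

To find a vector fixed by T, restrict V to the group U of upper unitriangular
matrices, which is cyclic of order p^n. Its subgroups form a chain, hence some
linear constituent psi of this restriction has the same kernel as the
restriction itself (faithful_constt_cyclic_pgroup). Take an eigenvector v of U
in V with eigencharacter psi. The torus normalises U, and it maps v to
eigenvectors whose eigencharacters are the conjugates of psi. An element t of T
that fixes psi satisfies [U, t] <= ker psi <= ker chi. If every such t acts
trivially on V, then the sum of the translates of v under T has the
psi-component |Stab_T(psi)| v, so it is a nonzero vector fixed by T
(Res_constt1_lin_constt).

It remains to see that t = diag(a, 1/a) with [U, t] <= ker chi lies in ker chi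
(torus_kernel). With b = 1/a, the commutators are the unipotent elements with
parameter (b^2 - 1) x = (b - 1)(b + 1) x. As R is local and 2 is a unit, one of
b - 1 and b + 1 is a unit; since -I lies in ker chi, t may be replaced by -t,
and ker chi contains the unipotent elements of all parameters (b - 1) x.
A matrix identity then writes diag(b, 1/b) as a product of conjugates of such
elements (torus_in_normal). The argument is uniform in n and distinguishes
neither the level of chi nor the types of irreducible characters. *)
Set Implicit Arguments.
Unset Strict Implicit.
Unset Printing Implicit Defensive.
Import GroupScope GRing.Theory Num.Theory.
Local Open Scope ring_scope.

(** * The conjugation character and centralisers *)

Section ConjugationCharacter.
Variables (gT : finGroupType) (G : {group gT}).

Lemma conj_charE g :
  g \in G -> conj_char G g = \sum_(x in G) (g \in 'C[x])%:R.
Proof.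
move=> Gg; rewrite cfunE Gg mulr1n /mxtrace [RHS]big_enum_val.
apply: eq_bigr => i _; rewrite mxE; congr ((_ : bool)%:R).
by rewrite (sameP cent1P eqP) eq_sym -(can_eq (mulgK g)) mulgKV.
Qed.

(** Both sides count the pairs of commuting elements of G with weight
conj (chi g). *)
Lemma cfdot_conj_char chi :
  '[conj_char G, chi] =
  #|G|%:R^-1 *
    \sum_(x in G) #|'C_G[x]|%:R * '[1, 'Res['C_G[x]] chi].
Proof.
rewrite cfdotE; congr (_ * _).
rewrite (eq_bigr (fun g => \sum_(x in G) (g \in 'C[x])%:R * (chi g)^*)).
  rewrite exchange_big /=; apply: eq_bigr => x Gx.
  rewrite cfdotE mulVKf ?neq0CG //.
  rewrite (bigID [in 'C[x]]) /= [X in _ + X]big1 => [|g /andP[_ /negPf->]].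
    rewrite addr0; apply: eq_big => [g|g /andP[Gg xg]].
      by rewrite in_setI.
    by rewrite cfun1E in_setI Gg xg cfResE ?subsetIl // in_setI Gg.
  by rewrite mul0r.
by move=> g Gg; rewrite conj_charE // mulr_suml.
Qed.

(** The terms of the preceding sum are nonnegative, being multiplicities scaled
by positive integers, so a single positive one suffices. *)
Lemma conj_char_constt chi x :
    chi \is a character -> x \in G -> '['Res['C_G[x]] chi, 1] != 0 ->
  '[conj_char G, chi] != 0.
Proof.
move=> Nchi Gx nz; rewrite cfdot_conj_char mulf_neq0 ?invr_eq0 ?neq0CG //.
have ge0 y : 0 <= #|'C_G[y]|%:R * '[1, 'Res['C_G[y]] chi] :> algC.
  rewrite mulr_ge0 ?ler0n // natr_ge0 //.
  by rewrite Cnat_cfdot_char ?cfun1_char ?cfRes_char.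
rewrite psumr_neq0 //; apply/hasP; exists x; first by rewrite mem_index_enum.
by rewrite Gx lt0r ge0 andbT mulf_neq0 ?neq0CG // cfdotC fmorph_eq0.
Qed.

End ConjugationCharacter.

(** * Fixed vectors of a group normalising a cyclic p-group *)

(** If P = C B is a full rank factorisation then C and B can be cancelled in
C (B C) B = c C B, so that B C, whose trace is that of P, is scalar. *)
Lemma mxtrace_quasi_idem (F : numFieldType) n (P : 'M[F]_n) c :
  P *m P = c *: P -> \tr P = c *+ \rank P.
Proof.
move: (mulmx_base P) (row_base_free P) (col_base_full P).
move: (row_base P) (col_base P) => B C defP freeB fullC PP.
suffices BC : B *m C = c%:M by rewrite -{1}defP mxtrace_mulC BC mxtrace_scalar.
apply: (row_free_inj freeB); apply: (row_full_inj fullC) => /=.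
by rewrite mul_scalar_mx -scalemxAr defP -PP !mulmxA defP -mulmxA defP.
Qed.

Section FixedVectors.
Variables (gT : finGroupType) (G U T : {group gT}).
Hypotheses (sUG : U \subset G) (sTG : T \subset G) (nUT : T \subset 'N(U)).

(** Orthogonality of psi and its conjugate by t: the summand is
psi [~ u, t], a homomorphism in u which is nontrivial at u0. *)
Lemma sum_lin_char_conj0 (psi : 'CF(U)) (t u0 : gT) :
    psi \is a linear_char -> t \in 'N(U) -> u0 \in U ->
    [~ u0, t] \notin cfker psi ->
  \sum_(u in U) psi (u^-1)%g * psi (u ^ t)%g = 0.
Proof.
move=> Lpsi nUt Uu0 nker; set S := \sum_(u in U) _.
have UJ u : u \in U -> (u ^ t)%g \in U by move=> Uu; rewrite memJ_norm.
have psi_comm u : u \in U -> psi (u^-1)%g * psi (u ^ t)%g = psi [~ u, t].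
  by move=> Uu; rewrite -lin_charM ?groupV ?UJ.
have shift : S = psi [~ u0, t] * S.
  rewrite {1}/S (reindex_inj (mulgI u0)) mulr_sumr; apply: eq_big => u.
    by rewrite groupMl.
  rewrite groupMl // => Uu; rewrite -psi_comm // invMg conjMg.
  rewrite [psi (_^-1 * _^-1)%g]lin_charM ?groupV //.
  by rewrite [psi (_ ^ t * _ ^ t)%g]lin_charM ?UJ //; ring.
have psi_neq1 : psi [~ u0, t] != 1.
  apply: contra nker => /eqP psi1; rewrite cfkerEchar ?lin_charW // inE.
  by rewrite groupM ?groupV ?UJ //= psi1 lin_char1.
apply/eqP; have /eqP := shift.
rewrite eq_sym -subr_eq0 -{2}[S]mul1r -mulrBl mulf_eq0 subr_eq0.
by rewrite (negPf psi_neq1).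
Qed.

(** Let e be the projection onto the psi-eigenspace of U, up to the scalar |U|,
and P the sum of the operators in T. For t in T, e t e is |U| e if t stabilises
psi, for then t acts trivially, and 0 otherwise, because t moves the
psi-eigenspace to another eigenspace. So e P e is a nonzero multiple of e; thus
P is nonzero, and so is its trace, which is |T| times the multiplicity of the
trivial character of T. *)
Lemma Res_constt1_lin_constt (chi : 'CF(G)) (psi : 'CF(U)) :
    chi \is a character -> psi \is a linear_char ->
    '['Res[U] chi, psi] != 0 ->
    (forall t, t \in T ->
       (forall u, u \in U -> [~ u, t] \in cfker psi) -> t \in cfker chi) ->
  '['Res[T] chi, 1] != 0.
Proof.
move=> /char_reprP[[n rG] ->] /= Lpsi nz_psi stab.
have UinG u : u \in U -> u \in G by apply: subsetP.
have TinG t : t \in T -> t \in G by apply: subsetP.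
have UV u : u \in U -> (u^-1)%g \in U by rewrite groupV.
have nUt t : t \in T -> t \in 'N(U) by apply: subsetP.
pose e := \sum_(u in U) psi (u^-1)%g *: rG u.
pose P := \sum_(t in T) rG t.
have rGe x : x \in U -> rG x *m e = psi x *: e.
  move=> Ux; rewrite /e mulmx_sumr scaler_sumr.
  rewrite [RHS](reindex_inj (mulgI x)); apply: eq_big => u.
    by rewrite groupMl.
  move=> Uu; rewrite -scalemxAr scalerA repr_mxM ?UinG // invMg.
  rewrite lin_charM ?UV // mulrCA -lin_charM ?UV // mulgV lin_char1 //.
  by rewrite mulr1.
(* The trace of e is |U| times the multiplicity of psi. *)
have nz_e : e != 0.
  apply: contraNneq nz_psi => e0; rewrite cfdotE.
  suffices ->: \sum_(x in U) 'Res[U] (cfRepr rG) x * (psi x)^* = \tr e.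
    by rewrite e0 mxtrace0 mulr0.
  rewrite /e raddf_sum; apply: eq_bigr => u Uu.
  by rewrite cfResE // cfunE UinG // mulr1n /= mxtraceZ lin_charV_conj // mulrC.
pose stT := [set t in T | [forall u in U, [~ u, t] \in cfker psi]].
have ePe : e *m P *m e = (#|stT|%:R * #|U|%:R) *: e.
  have ete t : t \in T -> e *m rG t *m e = ((t \in stT)%:R * #|U|%:R) *: e.
    move=> Tt.
    have -> : e *m rG t *m e
        = (\sum_(u in U) psi (u^-1)%g * psi (u ^ t)%g) *: (rG t *m e).
      rewrite /e !mulmx_suml -/e scaler_suml; apply: eq_bigr => u Uu.
      have [Gu Gt] := (UinG u Uu, TinG t Tt); have Ut := nUt t Tt.
      rewrite -!scalemxAl -repr_mxM // conjgC repr_mxM // ?UinG ?memJ_norm //.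
      by rewrite -mulmxA (rGe (u ^ t)%g) ?memJ_norm // -scalemxAr scalerA.
    case: (boolP (t \in stT)) => [|ntS].
      rewrite inE Tt /= => /forall_inP st.
      have := stab t Tt st; rewrite cfker_repr => /setIdP[_].
      rewrite mul1mx => /eqP->; rewrite mul1mx; congr (_ *: _).
      rewrite mul1r -sum1_card natr_sum; apply: eq_bigr => u Uu.
      rewrite -lin_charM ?UV ?memJ_norm ?nUt //.
      by rewrite (cfker1 (st u Uu)) lin_char1.
    move: ntS; rewrite inE Tt /= => /forall_inPn[u0 Uu0 nk].
    by rewrite (sum_lin_char_conj0 Lpsi (nUt t Tt) Uu0 nk) mul0r !scale0r.
  rewrite /P (mulmx_sumr e) mulmx_suml (eq_bigr _ ete) -scaler_suml.
  congr (_ *: _).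
  rewrite -mulr_suml; congr (_ * _); rewrite -sum1_card natr_sum.
  rewrite [RHS]big_mkcond [LHS]big_mkcond /=; apply: eq_bigr => t _.
  by rewrite inE; case: (t \in T) => //=; case: ifP.
have nzP : P != 0.
  apply: contraNneq nz_e => P0; move/eqP: ePe.
  rewrite P0 mulmx0 mul0mx eq_sym scaler_eq0 => /orP[|//].
  rewrite mulf_eq0 (negPf (neq0CG U)) orbF pnatr_eq0 -leqn0 leqNgt.
  case/negP; apply/card_gt0P; exists 1%g; rewrite inE group1.
  by apply/forall_inP=> u _; rewrite commg1 group1.
have PP : P *m P = #|T|%:R *: P.
  rewrite {1}/P mulmx_suml -sum1_card natr_sum scaler_suml.
  apply: eq_bigr => t Tt; rewrite scale1r /P mulmx_sumr.
  rewrite [RHS](reindex_inj (mulgI t)); apply: eq_big => s.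
    by rewrite groupMl.
  by move=> Ts; rewrite repr_mxM ?TinG.
have trP : \tr P != 0.
  by rewrite (mxtrace_quasi_idem PP) -mulr_natr mulf_neq0 ?neq0CG // pnatr_eq0
             mxrank_eq0.
rewrite cfdotE mulf_neq0 ?invr_eq0 ?neq0CG //.
suffices ->: \sum_(x in T) 'Res[T] (cfRepr rG) x * ((1 : 'CF(T)) x)^*
             = \tr P by [].
rewrite /P raddf_sum; apply: eq_bigr => t Tt.
by rewrite cfResE // cfunE TinG // mulr1n cfun1E Tt rmorph1 mulr1.
Qed.

End FixedVectors.

(** The kernel of phi is the intersection of the kernels of its constituents.
These kernels form a chain, the subgroups of a cyclic p-group being totally
ordered, so the smallest of them is the intersection. *)
Lemma faithful_constt_cyclic_pgroup (gT : finGroupType) (U : {group gT})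
    (p : nat) (phi : 'CF(U)) :
    cyclic U -> p.-group U -> phi \is a character -> phi != 0 ->
  exists2 i, i \in irr_constt phi & cfker 'chi_i = cfker phi.
Proof.
move=> cycU pU Nphi nz_phi.
have [i0 phi_i0] := neq0_has_constt nz_phi.
case: (arg_minnP (fun i => #|cfker 'chi_i|) phi_i0) => i phi_i min_i.
exists i => //; apply/eqP; rewrite eqEsubset cfker_constt // andbT.
rewrite [cfker phi]cfkerE // subsetI cfker_sub; apply/bigcapsP=> j phi_j.
rewrite -(cardSg_cyclic cycU) ?cfker_sub //.
have pow k : {a | #|cfker 'chi[U]_k| = (p ^ a)%N}.
  by apply: p_natP; apply: pgroupS pU; apply: cfker_sub.
have := min_i j phi_j; have := cardG_gt0 [group of cfker 'chi_i].
have [[a /= ->] [b ->]] := (pow i, pow j) => pa_gt0 le_pa_pb.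
have [lt_ab | /(dvdn_exp2l p) pb_pa] := ltnP a b.
  by rewrite dvdn_exp2l // ltnW.
by rewrite -(eqP (_ : p ^ a == p ^ b)%N) // eqn_leq le_pa_pb dvdn_leq.
Qed.

(** * Unipotent and diagonal elements of SL_2 *)

Section SL2.
Variable R : finComUnitRingType.

Definition mx2 (a b c d : R) : 'M[R]_2 :=
  \matrix_(i, j) if i == 0 then if j == 0 then a else b
                 else if j == 0 then c else d.

(** The value is the matrix (a b; c d) when its determinant is 1; the default
identity element is a junk value. *)
Definition sl2 (a b c d : R) : {'GL_2[R]} :=
  insubd (1%g : {'GL_2[R]}) (mx2 a b c d).

Definition unip x := sl2 1 x 0 1.
Definition lowunip x := sl2 1 0 x 1.
Definition torus a b := sl2 a 0 0 b.

Lemma det_mx2 a b c d : \det (mx2 a b c d) = a * d - b * c.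
Proof.
rewrite (expand_det_row _ 0) !big_ord_recl big_ord0 /cofactor !det_mx11 !mxE /=.
by ring.
Qed.

Lemma mul_mx2 a b c d a' b' c' d' :
  mx2 a b c d *m mx2 a' b' c' d' =
  mx2 (a * a' + b * c') (a * b' + b * d') (c * a' + d * c') (c * b' + d * d').
Proof.
apply/matrixP=> i j; rewrite !mxE !big_ord_recl big_ord0 !mxE /= addr0.
by case: i j => [[|[|//]] ?] [[|[|//]] ?].
Qed.

Lemma GLval_inj : injective (@GLval 2 R).
Proof. exact: val_inj. Qed.

Lemma sl2K a b c d : a * d - b * c = 1 -> GLval (sl2 a b c d) = mx2 a b c d.
Proof.
move=> det1; rewrite [LHS]insubdK //.
by rewrite -[_ \in _]/(_ \in unitmx) unitmxE det_mx2 det1 unitr1.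
Qed.

Lemma sl2_SL a b c d : a * d - b * c = 1 -> sl2 a b c d \in SL 2 R.
Proof. by move=> det1; rewrite inE sl2K // det_mx2 det1. Qed.

Lemma SL2P g : g \in SL 2 R ->
  exists a b c d, a * d - b * c = 1 /\ g = sl2 a b c d.
Proof.
pose i1 : 'I_2 := 0; pose i2 : 'I_2 := 1.
have : GLval g = mx2 (GLval g i1 i1) (GLval g i1 i2)
                     (GLval g i2 i1) (GLval g i2 i2).
  apply/matrixP=> i j; rewrite mxE.
  by case: i j => [[|[|//]] ?] [[|[|//]] ?] /=;
     congr (GLval g _ _); apply: val_inj.
move: (GLval g i1 i1) (GLval g i1 i2) (GLval g i2 i1) (GLval g i2 i2).
move=> a b c d Dg; rewrite inE Dg det_mx2 => /eqP det1.
by exists a, b, c, d; split=> //; apply: GLval_inj; rewrite sl2K.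
Qed.

Lemma sl2_inj a b c d a' b' c' d' :
    a * d - b * c = 1 -> a' * d' - b' * c' = 1 ->
  sl2 a b c d = sl2 a' b' c' d' -> [/\ a = a', b = b', c = c' & d = d'].
Proof.
move=> det1 det1' /(congr1 (@GLval 2 R)); rewrite !sl2K // => /matrixP eqM.
by split; [have := eqM 0 0 | have := eqM 0 1 | have := eqM 1 0
          | have := eqM 1 1]; rewrite !mxE.
Qed.

Lemma sl2M a b c d a' b' c' d' :
    a * d - b * c = 1 -> a' * d' - b' * c' = 1 ->
  (sl2 a b c d * sl2 a' b' c' d')%g =
  sl2 (a * a' + b * c') (a * b' + b * d') (c * a' + d * c') (c * b' + d * d').
Proof.
move=> det1 det1'; apply: GLval_inj; rewrite GL_MxE !sl2K ?mul_mx2 //.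
transitivity ((a * d - b * c) * (a' * d' - b' * c')); first by ring.
by rewrite det1 det1' mulr1.
Qed.

Lemma sl2_1 : sl2 1 0 0 1 = 1%g.
Proof.
apply: GLval_inj; rewrite sl2K ?GL_1E; last by ring.
by apply/matrixP=> i j; rewrite !mxE; case: i j => [[|[|//]] ?] [[|[|//]] ?].
Qed.

Lemma sl2_opp1 : sl2 (- 1) 0 0 (- 1) = GL_opp1 2 R.
Proof.
apply: GLval_inj; rewrite sl2K /=; last by ring.
apply/matrixP=> i j; rewrite !mxE.
by case: i j => [[|[|//]] ?] [[|[|//]] ?]; rewrite /= ?oppr0.
Qed.

Lemma unip_det x : 1 * 1 - x * 0 = 1 :> R. Proof. by ring. Qed.
Lemma lowunip_det x : 1 * 1 - 0 * x = 1 :> R. Proof. by ring. Qed.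
Lemma torus_det a b : a * b = 1 -> a * b - 0 * 0 = 1 :> R.
Proof. by move->; ring. Qed.

Lemma unip_SL x : unip x \in SL 2 R.
Proof. exact/sl2_SL/unip_det. Qed.

Lemma lowunip_SL x : lowunip x \in SL 2 R.
Proof. exact/sl2_SL/lowunip_det. Qed.

Lemma torus_SL a b : a * b = 1 -> torus a b \in SL 2 R.
Proof. by move=> ab1; apply/sl2_SL/torus_det. Qed.

Lemma unipD x y : (unip x * unip y)%g = unip (x + y).
Proof. by rewrite sl2M ?unip_det //; congr sl2; ring. Qed.

Lemma lowunipD x y : (lowunip x * lowunip y)%g = lowunip (x + y).
Proof. by rewrite sl2M ?lowunip_det //; congr sl2; ring. Qed.

Lemma torusM a b c d : a * b = 1 -> c * d = 1 ->
  (torus a b * torus c d)%g = torus (a * c) (b * d).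
Proof. by move=> ab1 cd1; rewrite sl2M ?torus_det //; congr sl2; ring. Qed.

Lemma unip0 : unip 0 = 1%g.
Proof. exact: sl2_1. Qed.

Lemma unipV x : (unip x)^-1%g = unip (- x).
Proof. by apply/eqP; rewrite eq_invg_mul unipD subrr unip0. Qed.

Lemma torusV a b : a * b = 1 -> (torus a b)^-1%g = torus b a.
Proof.
move=> ab1; have ba1 : b * a = 1 by rewrite mulrC.
by apply/eqP; rewrite eq_invg_mul torusM // ab1 ba1 [torus 1 1]sl2_1.
Qed.

Lemma unipX x k : (unip x ^+ k)%g = unip (x *+ k).
Proof. by elim: k => [|k IHk]; rewrite ?unip0 // expgS IHk unipD mulrS. Qed.

Lemma unipJ a b x : a * b = 1 -> (unip x ^ torus a b)%g = unip (b ^+ 2 * x).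
Proof.
move=> ab1; have ba1 : b * a = 1 by rewrite mulrC.
apply: (mulgI (torus a b)); rewrite -conjgC.
rewrite !sl2M ?unip_det ?torus_det //.
by congr sl2; ring: ab1.
Qed.

(** With c = a - 1 and b = 1 / a, the product of (1 c; 0 1) and (1 0; 1 1) is
(a c; 1 1), and its factorisation into a lower unitriangular, a diagonal and an
upper unitriangular matrix has diagonal part diag(a, b). Solving for the
diagonal part expresses it by conjugates of unipotent elements whose parameters
are multiples of c. *)
Lemma torus_in_normal (N : {group {'GL_2[R]}}) a b :
    SL 2 R \subset 'N(N) -> a * b = 1 ->
  (forall x, unip ((a - 1) * x) \in N) -> torus a b \in N.
Proof.
move=> nN ab1 Nu; have ba1 : b * a = 1 by rewrite mulrC.
have NJ g h : g \in N -> h \in SL 2 R -> (g ^ h)%g \in N.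
  by move=> Ng Sh; rewrite memJ_norm ?(subsetP nN).
have w_det : 0 * 0 - 1 * -1 = 1 :> R by ring.
pose w := sl2 0 1 (-1) 0.
(* A Weyl element conjugates upper into lower unitriangular matrices. *)
have Nl x : lowunip ((a - 1) * x) \in N.
  rewrite (_ : lowunip _ = unip ((a - 1) * - x)%R ^ w)%g.
    exact: (NJ _ _ (Nu _) (sl2_SL w_det)).
  apply: (mulgI w); rewrite -conjgC.
  by rewrite !sl2M ?unip_det ?lowunip_det //; congr sl2; ring.
have -> : torus a b =
    (unip ((a - 1) * 1)%R ^ lowunip b
       * (lowunip ((a - 1) * b)%R * unip ((a - 1) * - b)%R))%g.
  apply: (mulgI (lowunip b)); rewrite mulgA -conjgC -mulgA.
  rewrite (mulgA (lowunip b) (lowunip _)) lowunipD.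
  rewrite sl2M ?lowunip_det ?torus_det //.
  rewrite [X in (_ * X)%g]sl2M ?unip_det ?lowunip_det //.
  rewrite sl2M ?unip_det //; last by ring.
  congr sl2; ring: ab1.
by apply: groupM (NJ _ _ (Nu _) (lowunip_SL _)) (groupM (Nl _) (Nu _)).
Qed.

(** Comparing off-diagonal entries, (s - s') b = (s - s') c = 0 for a matrix
(a b; c d) that commutes with diag(s, s'). *)
Lemma centralizer_torus s s' g :
    s * s' = 1 -> s - s' \is a GRing.unit -> g \in 'C_(SL 2 R)[torus s s'] ->
  exists a b, a * b = 1 /\ g = torus a b.
Proof.
move=> ss' ds /setIP[/SL2P[a [b [c [d [det1 ->]]]]] /cent1P].
rewrite /commute !sl2M ?torus_det // => /sl2_inj[].
- transitivity ((a * d - b * c) * (s * s')); first by ring.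
  by rewrite det1 ss' mulr1.
- transitivity ((a * d - b * c) * (s * s')); first by ring.
  by rewrite det1 ss' mulr1.
move=> _ eqb eqc _.
have b0 : b = 0.
  by apply: (mulrI ds); rewrite mulr0; ring: eqb.
have c0 : c = 0.
  by apply: (mulrI ds); rewrite mulr0; ring: eqc.
exists a, d; rewrite b0 c0; split=> //.
by rewrite -det1 b0 mul0r subr0.
Qed.

(** The commutators in the hypothesis are the unipotent elements with parameter
(b - 1)(b + 1) x. In a local ring where 2 is a unit, b + 1 or 1 - b is a unit,
and can be absorbed in x. In the first case diag(b, a) is obtained from
torus_in_normal, in the second diag(-b, -a) is, which is as good modulo -I. *)
Lemma torus_kernel (N : {group {'GL_2[R]}}) a b :
    (forall x y : R, x + y \is a GRing.unit ->
       (x \is a GRing.unit) || (y \is a GRing.unit)) ->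
    (2 : R) \is a GRing.unit ->
    SL 2 R \subset 'N(N) -> GL_opp1 2 R \in N -> a * b = 1 ->
  (forall x, [~ unip x, torus a b] \in N) -> torus a b \in N.
Proof.
move=> local unit2 nN Nz ab1 Ncomm; have ba1 : b * a = 1 by rewrite mulrC.
have kerU x : unip ((b - 1) * (b + 1) * x) \in N.
  have := Ncomm x; rewrite /commg unipJ // unipV unipD.
  by rewrite (_ : - x + _ = (b - 1) * (b + 1) * x); last by ring.
rewrite -groupV torusV //.
have /orP[ub | ub] : (b + 1 \is a GRing.unit) || (1 - b \is a GRing.unit).
- by apply: local; rewrite (_ : _ + _ = 2) //; ring.
- apply: (torus_in_normal nN ba1) => x.
  by rewrite -[x](mulVKr ub) (mulrA (b - 1)); apply: kerU.
have nbna : - b * - a = 1 by rewrite mulrNN.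
have : torus (- b) (- a) \in N.
  apply: (torus_in_normal nN nbna) => x.
  suff -> : (- b - 1) * x = (b - 1) * (b + 1) * ((1 - b)^-1 * x).
    exact: kerU.
  by rewrite -{1}[x](mulVKr ub); ring.
have -> : torus (- b) (- a) = (GL_opp1 2 R * torus b a)%g.
  by rewrite -sl2_opp1 torusM ?mulrNN ?mulr1 //; congr sl2; ring.
by rewrite groupMl.
Qed.

(** * The torus fixes a vector *)

Section CyclicAdditiveGroup.
Hypothesis natR : forall x : R, exists k, x = k%:R.

Lemma unip_cycleP u :
  reflect (exists x, u = unip x) (u \in <[unip 1%R]>%g).
Proof.
apply: (iffP (cycleP _ _)) => [[k ->]|[x ->]].
  by exists (1 *+ k); rewrite unipX.
by have [k ->] := natR x; exists k; rewrite unipX.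
Qed.

Lemma unip_pgroup (p q : nat) :
  p.-nat q -> q%:R = 0 :> R -> p.-group <[unip 1%R]>%g.
Proof.
move=> p_q q0; apply: pnat_dvd p_q.
by rewrite order_dvdn unipX q0 unip0.
Qed.

(** The ring is kept abstract: its additive group is cyclic of p-power order,
and it is local with 2 and 3 invertible. The invertibility of 3 serves to make
diag(2, 1/2) regular, as 2 (2 - 1/2) = 3. *)
Lemma SL2_conj_char_constt (p q : nat) (chi : 'CF(SL 2 R)) :
    (forall x y : R, x + y \is a GRing.unit ->
       (x \is a GRing.unit) || (y \is a GRing.unit)) ->
    (2 : R) \is a GRing.unit -> (3 : R) \is a GRing.unit ->
    p.-nat q -> q%:R = 0 :> R ->
    chi \is a character -> chi != 0 -> GL_opp1 2 R \in cfker chi ->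
  '[conj_char (SL 2 R), chi] != 0.
Proof.
move=> local unit2 unit3 p_q q0 Nchi nz_chi ker_z.
pose s : R := 2; pose s' := s^-1.
have ss' : s * s' = 1 by rewrite divrr.
have ds : s - s' \is a GRing.unit.
  rewrite -(unitrMr _ unit2) mulrBr divrr //.
  by rewrite (_ : 2 * 2 - 1 = 3) //; ring.
pose U := <[unip 1%R]>%G.
pose T := 'C_(SL 2 R)[torus s s']%G.
have sUG : U \subset SL 2 R by rewrite cycle_subG unip_SL.
have sTG : T \subset SL 2 R by apply: subsetIl.
have TP t : t \in T -> exists a b, a * b = 1 /\ t = torus a b.
  exact: (centralizer_torus ss' ds).
have nUT : T \subset 'N(U).
  apply/subsetP=> _ /TP[a [b [ab1 ->]]]; rewrite inE.
  apply/subsetP=> _ /imsetP[_ /unip_cycleP[x ->] ->].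
  by apply/unip_cycleP; exists (b ^+ 2 * x); rewrite unipJ.
have NresU : 'Res[U] chi \is a character by rewrite cfRes_char.
have nzU : 'Res[U] chi != 0 by rewrite cfRes_eq0.
have [i chi_i ker_i] := faithful_constt_cyclic_pgroup (cycle_cyclic _)
  (unip_pgroup p_q q0) NresU nzU.
apply: (@conj_char_constt _ _ _ (torus s s')) => //; first exact: torus_SL.
have Li : 'chi_i \is a linear_char.
  by apply/char_abelianP; apply: cyclic_abelian (cycle_cyclic _).
apply: (Res_constt1_lin_constt sUG sTG nUT Nchi Li) => [|t].
  by rewrite -irr_consttE.
move=> /TP[a [b [ab1 ->]]] stab.
apply: (torus_kernel local unit2 (cfker_norm chi)) => // x.
have Ux : unip x \in U by apply/unip_cycleP; exists x.
by have := stab _ Ux; rewrite ker_i cfker_Res // => /setIP[].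
Qed.

End CyclicAdditiveGroup.

End SL2.

(** * The ring of integers modulo a prime power *)

Section ZpPrimePower.
Variables (p n : nat).
Hypotheses (p_prime : prime p) (n_gt0 : (0 < n)%N).
Local Notation R := 'Z_(p ^ n).

Lemma primeX_gt1 : (1 < p ^ n)%N.
Proof. by rewrite -(exp1n n) ltn_exp2r // prime_gt1. Qed.

Lemma unit_natZpn k : (k%:R \is a @GRing.unit R) = ~~ (p %| k)%N.
Proof. by rewrite unitZpE ?primeX_gt1 // coprime_pexpl // prime_coprime. Qed.

Lemma unit_addZpn (x y : R) :
  x + y \is a GRing.unit -> (x \is a GRing.unit) || (y \is a GRing.unit).
Proof.
rewrite -(natr_Zp x) -(natr_Zp y) -natrD !unit_natZpn -negb_and.
by apply: contra => /andP[px py]; rewrite dvdn_add.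
Qed.

End ZpPrimePower.

Theorem theorem2 (p n : nat) (p_prime : prime p) (p_ge5 : (5 <= p)%N)
    (n_ge1 : (1 <= n)%N) (chi : 'CF(SL 2 'Z_(p ^ n))) :
  chi \in irr (SL 2 'Z_(p ^ n)) ->
  GL_opp1 2 'Z_(p ^ n) \in cfker chi ->
  '[conj_char (SL 2 'Z_(p ^ n)), chi] != 0.
Proof.
move=> irr_chi ker_z.
have unitR k : (0 < k < 5)%N -> k%:R \is a @GRing.unit 'Z_(p ^ n).
  case/andP=> k_gt0 k_lt5; rewrite unit_natZpn //.
  apply/negP=> /(dvdn_leq k_gt0).
  by rewrite leqNgt (leq_trans k_lt5 p_ge5).
apply: (@SL2_conj_char_constt _ _ p (p ^ n)) => //.
- by move=> x; exists x; rewrite natr_Zp.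
- exact: unit_addZpn.
- exact: (unitR 2%N).
- exact: (unitR 3%N).
- by rewrite pnatX pnat_id.
- by rewrite pchar_Zp ?primeX_gt1.
- exact: irrWchar.
- by have [i ->] := irrP irr_chi; apply: irr_neq0.
Qed.
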